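(* Let $\langle F_1,E_1\rangle$ and $\langle F_2,E_2\rangle$ be weak-* sequentially complete anti-dual pairs and let $A\in\mathscr{L}(E_1;F_1)$ and $B\in\mathscr{L}(E_1;F_2)$ be (weakly continuous, everywhere defined, linear) operators such that $A\geq 0$. Let $H_A$ and $J:H_A\to F_1$ be the Hilbert space and canonical embedding operator associated with $A$ (see context). Then the following assertions are equivalent: (i) There is a positive operator $C\in\mathscr{L}(E_2;F_2)$ such that the operator matrix $\begin{bmatrix} A & B^* \\ B & C \end{bmatrix}$ is positive. (ii) For every $y_2\in E_2$ there exists a constant $M_{y_2}\geq 0$ such that $|\langle Bx_1,y_2\rangle|^2\leq M_{y_2}\,\langle Ax_1,x_1\rangle$ for all $x_1\in E_1$. (iii) $\operatorname{ran}B^*\subseteq\operatorname{ran}J$. If any of these conditions is fulfilled, then the linear operator $$S_0:H_A\supseteq\operatorname{ran}A\to F_2,\qquad Ax_1\mapsto Bx_1,\qquad x_1\in E_1,$$ is well defined and weakly continuous. Furthermore, its unique continuous extension $S\in\mathscr{L}(H_A;F_2)$ has the property that $A_B:=SS^*$ is the smallest positive operator in $\mathscr{L}(E_2;F_2)$ that makes the incomplete matrix $\begin{bmatrix} A & B^* \\ B & * \end{bmatrix}$ positive. The quadratic form of $A_B$ is given, for $y_2\in E_2$, by $$\langle SS^*y_2,y_2\rangle=\sup\{|\langle Bx_1,y_2\rangle|^2: x_1\in E_1,\ \langle Ax_1,x_1\rangle\leq 1\}$$ $$=\sup\{\langle Bx_1,y_2\rangle+\langle B^*y_2,x_1\rangle-\langle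 Ax_1,x_1\rangle: x_1\in E_1\}.$$
   Context: An anti-dual pair $\langle F,E\rangle$ is a pair of complex vector spaces $E,F$ together with a separating sesquilinear map $\langle\cdot,\cdot\rangle:F\times E\to\mathbb{C}$ (linear in the $F$-variable, conjugate-linear in the $E$-variable). $E$ and $F$ are endowed with the weak topologies $\sigma(E,F)$ and $\sigma(F,E)$ respectively. The pair is called weak-* sequentially complete if $(F,\sigma(F,E))$ is sequentially complete. A Hilbert space $H$ forms an anti-dual pair $\langle H,H\rangle$ with itself via its inner product. For anti-dual pairs $\langle F_1,E_1\rangle$, $\langle F_2,E_2\rangle$, $\mathscr{L}(E_1;F_2)$ denotes the set of everywhere defined linear operators $T:E_1\to F_2$ that are weakly continuous, i.e. $\sigma(E_1,F_1)$-$\sigma(F_2,E_2)$-continuous. The adjoint of such a $T$ is the weakly continuous linear operator $T^*:E_2\to F_1$ with $\langle Tx_1,x_2\rangle_2=\overline{\langle T^*x_2,x_1\rangle_1}$ for all $x_1\in E_1$, $x_2\in E_2$. In particular, for $S\in\mathscr{L}(H;F_2)$ with $H$ a Hilbert space, $S^*\in\mathscr{L}(E_2;H)$ and $SS^*\in\mathscr{L}(E_2;F_2)$. A linear operator $A\in\mathscr{L}(E;F)$ is positive ($A\geq0$) if $\langle Ax,x\rangle\geq 0$ for all $x\in E$; $A\leq A'$ means $A'-A\geq0$, and ''smallest'' refers to this order. Operator matrices act from $E_1\times E_2$ to $F_1\times F_2$, where $\langle F_1\times F_2,E_1\times E_2\rangle$ is the anti-dual pair with pairing $\langle (f_1,f_2),(x_1,x_2)\rangle=\langle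 f_1,x_1\rangle_1+\langle f_2,x_2\rangle_2$. An operator $C\in\mathscr{L}(E_2;F_2)$ makes the incomplete matrix positive if the matrix obtained by replacing $*$ with $C$ is a positive operator. For positive $A\in\mathscr{L}(E_1;F_1)$, $H_A$ is the Hilbert space completion of $\operatorname{ran}A$ with respect to the (well-defined) inner product $(Ax\,|\,Ax')_A:=\langle Ax,x'\rangle$, $x,x'\in E_1$. The map $J_0:H_A\supseteq\operatorname{ran}A\to F_1$, $J_0(Ax):=Ax$, is weakly continuous and, by weak-* sequential completeness, extends uniquely to a continuous operator $J\in\mathscr{L}(H_A;F_1)$, called the canonical embedding operator. *)

(* Defs.v *)
From HB Require Import structures.
From mathcomp Require Import all_boot all_order all_algebra sesquilinear complex.
From mathcomp Require Import all_classical all_reals all_analysis.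

Set Implicit Arguments.
Unset Strict Implicit.
Unset Printing Implicit Defensive.

Import Order.TTheory GRing.Theory Num.Theory numFieldNormedType.Exports.
Local Open Scope classical_set_scope.
Local Open Scope ring_scope.

(* The second scaling makes the pairing conjugate-linear in the right variable. *)
Record antiDualPair (R : realType) (F E : lmodType R[i]) := AntiDualPair {
  pairing :> {bilinear F -> E -> R[i] | *%R & (@Num.conj R[i]) \; *%R} ;
  pairing_sepl : forall f : F, (forall x : E, pairing f x = 0) -> f = 0 ;
  pairing_sepr : forall x : E, (forall f : F, pairing f x = 0) -> x = 0 }.

(* weakE P and weakF P are the sets E and F with sigma(E,F) and sigma(F,E), the
   coarsest topologies (here, uniformities) making every map x |-> P f x,
   respectively f |-> P f x, continuous: they are induced by the embeddings of E
   and F into the products C^F and C^E. *)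
Definition weakE (R : realType) (F E : lmodType R[i]) (P : antiDualPair F E)
    : uniformType :=
  initial_topology (fun x : E =>
    (fun f : F => P f x) : prod_topology (fun _ : F => R[i] : numFieldType)).

Definition weakF (R : realType) (F E : lmodType R[i]) (P : antiDualPair F E)
    : uniformType :=
  initial_topology (fun f : F =>
    (fun x : E => P f x) : prod_topology (fun _ : E => R[i] : numFieldType)).

Definition weak_star_seq_complete (R : realType) (F E : lmodType R[i])
    (P : antiDualPair F E) : Prop :=
  forall u : nat -> weakF P, cauchy (u @ \oo) ->
    exists l : weakF P, u @ \oo --> l.

Section WeakOperators.
Context (R : realType) (F1 E1 F2 E2 : lmodType R[i]).
Context (P1 : antiDualPair F1 E1) (P2 : antiDualPair F2 E2).

(* The set L(E1; F2). *)
Definition weakOp : set (E1 -> F2) :=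
  [set T | linear T /\ continuous (T : weakE P1 -> weakF P2)].

(* Continuity of T restricted to D, with the relative topology on D. *)
Definition weakly_continuous_on (D : set E1) (T : E1 -> F2) : Prop :=
  {within (D : set (weakE P1)), continuous (T : weakE P1 -> weakF P2)}.

(* T^* y is the element f of F1 with <T x, y> = conj <f, x> for all x. It is
   unique by separation (adjoint_unique) and exists for T in L(E1; F2), the
   weakly continuous linear functionals of E1 being conjugates of pairings; the
   value 0 is used only when there is no such f. *)
Definition adjoint (T : E1 -> F2) (y : E2) : F1 :=
  xget 0 [set f | forall x : E1, P2 (T x) y = (P1 f x)^*].

Lemma adjoint_unique (T : E1 -> F2) (y : E2) (f : F1) :
  (forall x : E1, P2 (T x) y = (P1 f x)^*) -> adjoint T y = f.
Proof.
move=> fP; rewrite /adjoint; case: xgetP => [g _ gP|/(_ f)//].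
apply/eqP; rewrite -subr_eq0; apply/eqP/(pairing_sepl (a := P1)) => x.
rewrite linearBl/=; apply/eqP; rewrite subr_eq0; apply/eqP.
by apply: (can_inj conjCK); rewrite -fP -gP.
Qed.
End WeakOperators.

Definition positiveOp (R : realType) (F E : lmodType R[i])
    (P : antiDualPair F E) (T : E -> F) : Prop :=
  weakOp P P T /\ forall x : E, 0 <= P (T x) x.

Definition leOp (R : realType) (F E : lmodType R[i])
    (P : antiDualPair F E) (T T' : E -> F) : Prop :=
  positiveOp P (fun x => T' x - T x).

Section ProductPair.
Context (R : realType) (F1 E1 F2 E2 : lmodType R[i]).
Context (P1 : antiDualPair F1 E1) (P2 : antiDualPair F2 E2).

Definition prod_pairing (f : F1 * F2) (x : E1 * E2) : R[i] :=
  P1 f.1 x.1 + P2 f.2 x.2.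

Fact prod_pairing_bilinear :
  bilinear_for *%R ((@Num.conj R[i]) \; *%R) prod_pairing.
Proof.
split=> [x a f g|f a x y]; rewrite /prod_pairing /=.
  by rewrite !linearPl/= mulrDr addrACA.
by rewrite !linearPr/= mulrDr addrACA.
Qed.

HB.instance Definition _ :=
  bilinear_isBilinear.Build R[i] (F1 * F2)%type (E1 * E2)%type R[i] *%R
    ((@Num.conj R[i]) \; *%R) prod_pairing prod_pairing_bilinear.

Fact prod_pairing_sepl (f : F1 * F2) :
  (forall x : E1 * E2, prod_pairing f x = 0) -> f = 0.
Proof.
case: f => f1 f2 f0; congr (_, _).
  apply: (pairing_sepl (a := P1)) => x.
  by have := f0 (x, 0); rewrite /prod_pairing/= linear0r addr0.
apply: (pairing_sepl (a := P2)) => x.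
by have := f0 (0, x); rewrite /prod_pairing/= linear0r add0r.
Qed.

Fact prod_pairing_sepr (x : E1 * E2) :
  (forall f : F1 * F2, prod_pairing f x = 0) -> x = 0.
Proof.
case: x => x1 x2 x0; congr (_, _).
  apply: (pairing_sepr (a := P1)) => f.
  by have := x0 (f, 0); rewrite /prod_pairing/= linear0l addr0.
apply: (pairing_sepr (a := P2)) => f.
by have := x0 (0, f); rewrite /prod_pairing/= linear0l add0r.
Qed.

Definition prod_pair : antiDualPair (F1 * F2)%type (E1 * E2)%type :=
  AntiDualPair prod_pairing_sepl prod_pairing_sepr.

(* The matrix with rows (T11, T12) and (T21, T22). *)
Definition opMatrix (T11 : E1 -> F1) (T12 : E2 -> F1)
    (T21 : E1 -> F2) (T22 : E2 -> F2) (x : E1 * E2) : F1 * F2 :=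
  (T11 x.1 + T12 x.2, T21 x.1 + T22 x.2).

Definition completes (A : E1 -> F1) (B : E1 -> F2) (C : E2 -> F2) : Prop :=
  weakOp P2 P2 C /\ positiveOp prod_pair (opMatrix A (adjoint P1 P2 B) B C).
End ProductPair.

(* The inner product is linear in the left variable. *)
Record hilbertSpace (R : realType) := HilbertSpace {
  hilbert_sort :> completeNormedModType R[i] ;
  inner : {dot hilbert_sort for (@Num.conj R[i])} ;
  inner_norm : forall h : hilbert_sort, inner h h = `|h| ^+ 2 }.

Section HilbertPair.
Context (R : realType) (H : hilbertSpace R).

Fact inner_sepl (h : H) : (forall k : H, inner H h k = 0) -> h = 0.
Proof.
move=> /(_ h)/eqP; rewrite inner_norm expf_eq0/= normr_eq0.
by move=> /eqP.
Qed.

Fact inner_sepr (k : H) : (forall h : H, inner H h k = 0) -> k = 0.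
Proof.
move=> /(_ k)/eqP; rewrite inner_norm expf_eq0/= normr_eq0.
by move=> /eqP.
Qed.

Definition hilbert_pair : antiDualPair H H := AntiDualPair inner_sepl inner_sepr.
End HilbertPair.

Section AssociatedHilbertSpace.
Context (R : realType) (F E : lmodType R[i]) (P : antiDualPair F E).
Context (A : E -> F) (H : hilbertSpace R).

(* H together with k is the completion of ran A for (A x | A x') := <A x, x'>:
   k, of which only the restriction to ran A is relevant, is the inclusion of
   ran A into H. *)
Record is_completion (k : F -> H) : Prop := IsCompletion {
  completion_linear : forall (a : R[i]) (f g : F), range A f -> range A g ->
    k (a *: f + g) = a *: k f + k g ;
  completion_inner : forall x x' : E, inner H (k (A x)) (k (A x')) = P (A x) x' ;
  completion_dense : closure (k @` range A) = [set: H] }.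

Definition canonical_embedding (k : F -> H) (J : H -> F) : Prop :=
  weakOp (hilbert_pair H) P J /\ forall x : E, J (k (A x)) = A x.
End AssociatedHilbertSpace.

(* Main.v *)
From HB Require Import structures.
Require Import Defs.
From mathcomp Require Import all_boot all_order all_algebra sesquilinear complex.
From mathcomp Require Import all_classical all_reals all_analysis.
From mathcomp Require Import ring.
Import Order.TTheory GRing.Theory Num.Theory numFieldNormedType.Exports.
Local Open Scope classical_set_scope.
Local Open Scope ring_scope.

(** The space H_A turns the statement into Hilbert space geometry: with
[(k (A x) | k (A x')) = <A x, x'>], condition (ii) says that
[k (A x) |-> <B x, y>] is bounded for every [y], hence represented by a vector
[h y] of H_A, found by minimizing [|k (A x)|^2 - 2 Re <B x, y>].  Sequential
completeness gives [S] with [<S u, y> = (u | h y)], so that [S^* = h] and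
[<S S^* y, y> = |h y|^2].  The form of the matrix with corner [C] at [(x, y)] is
[|k (A x) + h y|^2 - |h y|^2 + <C y, y>], and density of the [k (A x)] yields
minimality and, similarly, both formulas for the quadratic form. *)

(** * Convergence in initial and product topologies, and Cauchy filters *)

Lemma cvg_initialP (S : choiceType) (T : topologicalType) (f : S -> T)
    (F : set_system S) {FF : Filter F} (s : S) :
  F --> (s : initial_topology f) <-> f @ F --> f s.
Proof.
split=> [Fs|fF A [B [[C oC <-] Cs] CA]].
  by apply: (@cvg_comp _ _ _ id f F (nbhs (s : initial_topology f))) => //;
     exact: initial_continuous.
by apply: filterS CA _; apply: fF; exact: open_nbhs_nbhs.
Qed.

Lemma cvg_prodP (I : Type) (T : I -> topologicalType)
    (F : set_system (prod_topology T)) {FF : Filter F} (g : prod_topology T) :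
  F --> g <-> forall i, (fun f : prod_topology T => f i) @ F --> g i.
Proof.
split=> [Fg i|Fg].
  apply: (iffLR (@cvg_initialP (prod_topology T) (T i) (fun f => f i) F FF g)).
  by have /cvg_sup/(_ i) := Fg.
apply/cvg_sup => i.
exact: (iffRL (@cvg_initialP (prod_topology T) (T i) (fun f => f i) F FF g)).
Qed.

Lemma cvg_to_cauchy {T : uniformType} {G : set_system T} {FG : Filter G}
    (l : T) : G --> l -> cauchy G.
Proof.
move=> Gl A /entourage_split_ex[B entB BA].
exists (xsection (B^-1%relation) l, xsection B l).
  split; apply: Gl; rewrite -nbhs_entourageE; last by exists B.
  by exists B^-1%relation => //; exact: entourage_inv.
by move=> [x y] [/xsectionP lx /xsectionP ly]; apply: BA; exists l.
Qed.

(** * The weak topologies of an anti-dual pair *)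

Section WeakTopology.
Context {R : realType} {F E : lmodType R[i]} (P : antiDualPair F E).
Local Notation K := (R[i] : numFieldType).

Lemma cvg_weakEP (G : set_system E) {FG : Filter G} (x : E) :
  G --> (x : weakE P) <-> forall f : F, (P f : E -> K) @ G --> (P f x : K).
Proof.
split=> [/cvg_initialP Gx f|Gx].
  exact: (iffLR (@cvg_prodP _ _ _ _ _) Gx).
by apply/cvg_initialP; apply/cvg_prodP.
Qed.

Lemma cvg_weakFP (G : set_system F) {FG : Filter G} (f : F) :
  G --> (f : weakF P) <-> forall x : E, (P^~ x : F -> K) @ G --> (P f x : K).
Proof.
split=> [/cvg_initialP Gf x|Gf].
  exact: (iffLR (@cvg_prodP _ _ _ _ _) Gf).
by apply/cvg_initialP; apply/cvg_prodP.
Qed.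

(** The sequence converges to [g] in the product space, where [g] need not come from [F], so it is
    Cauchy there. The uniformity of [weakF P] is induced from that product, so [u] is Cauchy in
    [weakF P], and its weak limit has the same pairings as [g]. *)
Lemma weakF_seq_complete (Pc : weak_star_seq_complete P) (u : nat -> F)
    (g : E -> K) :
  (forall x, (P (u n) x : K) @[n --> \oo] --> g x) ->
  exists f : F, forall x, P f x = g x.
Proof.
move=> ug.
pose emb (f : F) : prod_topology (fun _ : E => K) :=
  fun x => P f x.
have embu : emb \o u @ \oo --> (g : prod_topology (fun _ => K)).
  exact/cvg_prodP.
have [|l ul] := Pc u.
  have uc := cvg_to_cauchy _ embu.
  move=> A [B entB BA].
  have [[X Y] [/= uX uY] XY] := uc _ B entB.
  exists (emb @^-1` X, emb @^-1` Y) => // -[f h] [Xf Yh].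
  by apply: BA; apply: XY.
exists l => x; have {}ul : (P (u n) x : K) @[n --> \oo] --> (P l x : K).
  exact: (iffLR (@cvg_weakFP _ _ _) ul x).
exact: (@cvg_unique K (@norm_hausdorff _ K) _ _ _ _ ul (ug x)).
Qed.

End WeakTopology.

Lemma conj_continuous (C : numClosedFieldType) :
  continuous (Num.conj : (C : numFieldType) -> (C : numFieldType)).
Proof.
move=> x A [e e0 eA]; exists e => // y xy; apply: eA.
by rewrite /ball_/= -rmorphB norm_conjC.
Qed.

(** * Weakly continuous linear functionals are conjugates of pairings *)

Section WeakFunctionals.
Context {R : realType} {F E : lmodType R[i]} (P : antiDualPair F E).
Local Notation K := (R[i] : numFieldType).

(* Induction on [s]: subtracting a multiple of [g] from [phi] makes it vanish on
   the common kernel of the remaining functionals. *)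
Lemma functional_kernel_span (s : seq F) (phi : {scalar E}) :
  (forall x, {in s, forall f, P f x = 0} -> phi x = 0) ->
  exists f : F, forall x, phi x = (P f x)^*.
Proof.
elim: s phi => [phi phi0|g s IHs phi phi0].
  by exists 0 => x; rewrite phi0// linear0l conjC0.
have [gs|] := pselect (forall x, {in s, forall f, P f x = 0} -> P g x = 0).
  apply: IHs => x xs; apply: phi0 => f; rewrite in_cons => /predU1P[->|].
    exact: gs.
  exact: xs.
move=> /existsNP[x0] /not_implyP[x0s /eqP gx0].
pose psi x := phi x - phi x0 / (P g x0)^* * (P g x)^*.
have psi_lin : scalar psi.
  move=> a x y; rewrite /psi linearP linearPr/= rmorphD rmorphM/= conjCK.
  by rewrite !mulrBr mulrDr !mulrA opprD addrACA [_ * a]mulrC !mulrA.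
pose psiL : {scalar E} :=
  HB.pack psi (GRing.isLinear.Build _ _ _ _ psi psi_lin).
have [|f fP] := IHs psiL.
  move=> x xs; rewrite /= /psi.
  (* The multiple of [x0] moves [x] into the kernel of [g]; its coefficient is conjugated because
     the pairing is conjugate-linear in this variable. *)
  have /eqP : phi (x - (P g x / P g x0)^* *: x0) = 0.
    apply: phi0 => f; rewrite in_cons linearBr/= linearZr_LR/= conjCK.
    move=> /predU1P[->|fs]; first by rewrite divfK// subrr.
    by rewrite (xs f fs) (x0s f fs) mulr0 subrr.
  rewrite linearB linearZ/= subr_eq0 => /eqP ->.
  by rewrite rmorphM/= fmorphV mulrAC mulrC mulrA [_ * phi x0]mulrC mulrA subrr.
exists (f + (phi x0 / (P g x0)^*)^* *: g) => x.
rewrite linearDl/= linearZl_LR/= rmorphD rmorphM/= conjCK -fP/=.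
by rewrite /psi subrK.
Qed.

(** Continuity at 0 bounds [phi] by 1 on the common kernel of finitely many pairings. This kernel is
    closed under scaling, so [phi] vanishes on it and [functional_kernel_span] applies. *)
Lemma weakE_functional (phi : {scalar E}) :
  continuous ((phi : E -> K) : weakE P -> K) ->
  exists f : F, forall x, phi x = (P f x)^*.
Proof.
move=> phic.
(* The common kernels of finitely many functionals already form a filter that
   converges weakly to 0. *)
pose G : set_system E :=
  filter_from [set: seq F] (fun s => [set x | {in s, forall f, P f x = 0}]).
have FG : Filter G.
  apply: filter_from_filter; first by exists [::].
  move=> s t _ _; exists (s ++ t) => // x /= xst.
  by split => f fs; apply: xst; rewrite mem_cat fs ?orbT.
have G0 : G --> (0 : weakE P).
  apply/cvg_weakEP => f; rewrite linear0r.
  apply/cvgrPdist_lt => e e0; exists [:: f] => // x /= xf.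
  by rewrite xf ?mem_head// subr0 normr0.
have /cvgrPdist_lt/(_ 1 ltr01)[s _ sP] : (phi : E -> K) @ G --> (phi 0 : K).
  exact: cvg_trans (cvg_app _ G0) (phic 0).
apply: (@functional_kernel_span s) => x xs; apply/eqP/negP => /negP phix.
have /sP/= : {in s, forall f, P f ((phi x)^-1 *: x) = 0}.
  by move=> f fs; rewrite linearZr_LR/= xs// mulr0.
by rewrite linear0 sub0r normrN linearZ/= mulVf// normr1 ltxx.
Qed.

End WeakFunctionals.

(** * Weakly continuous operators and their adjoints *)

Section WeakOperators.
Context {R : realType} {F1 E1 F2 E2 : lmodType R[i]}.
Context (P1 : antiDualPair F1 E1) (P2 : antiDualPair F2 E2).
Local Notation K := (R[i] : numFieldType).

(** This replaces weak continuity by an algebraic condition: each functional [P2 (T x) y] of [x] is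
    weakly continuous, hence given by a vector [T' y]. Conversely, such a formula makes every
    coordinate of [T] continuous. *)
Lemma weakOpP (T : E1 -> F2) : weakOp P1 P2 T <->
  linear T /\
  exists T' : E2 -> F1, forall x y, P2 (T x) y = (P1 (T' y) x)^*.
Proof.
split=> [[Tlin Tc]|[Tlin [T' T'P]]]; split=> //.
  suff /choice[T' T'P] : forall y, exists f, forall x, P2 (T x) y = (P1 f x)^*.
    by exists T' => x y; exact: T'P.
  move=> y; pose phi x := P2 (T x) y.
  have phi_lin : scalar phi.
    by move=> a u v; rewrite /phi Tlin linearPl.
  pose phiL : {scalar E1} :=
    HB.pack phi (GRing.isLinear.Build _ _ _ _ phi phi_lin).
  apply: (@weakE_functional _ _ _ P1 phiL) => x.
  have FT := fmap_filter T (nbhs_filter x).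
  exact: (iffLR (@cvg_weakFP _ _ _ P2 _ FT _) (Tc x) y).
move=> x.
have FT := fmap_filter T (nbhs_filter x).
apply: (iffRL (@cvg_weakFP _ _ _ P2 _ FT _)) => y.
suff : ((fun z => P2 (T z) y) : E1 -> K) @ nbhs (x : weakE P1) -->
  (P2 (T x) y : K) by [].
have -> : (fun z => P2 (T z) y) = Num.conj \o (P1 (T' y) : E1 -> K).
  by apply/funext => z; exact: T'P.
rewrite T'P.
apply: (@cvg_comp _ _ _ _ _ _ (nbhs (P1 (T' y) x : K))).
  exact: (iffLR (@cvg_weakEP _ _ _ P1 _ (nbhs_filter x) x) cvg_id).
exact: conj_continuous.
Qed.

Lemma weakOp_adjoint (T : E1 -> F2) : weakOp P1 P2 T ->
  forall x y, P2 (T x) y = (P1 (adjoint P1 P2 T y) x)^*.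
Proof.
move=> /weakOpP[_ [T' T'P]] x y.
by rewrite (@adjoint_unique _ _ _ _ _ P1 P2 T y (T' y)).
Qed.

End WeakOperators.

(** * Discriminant bounds for nonnegative forms *)

Lemma quadratic_ge0_bound (C : numFieldType) (m q c : C) :
  0 <= m -> 0 <= q ->
  (forall s, s \is Num.real -> 0 <= s ^+ 2 * (m * q) - 2 * (s * m) + c) ->
  m <= c * q.
Proof.
move=> m0 q0 smq.
have c0 : 0 <= c.
  by have := smq 0 (real0 C); rewrite expr0n/= !mul0r mulr0 subrr add0r.
have [qE|qN0] := eqVneq q 0.
  have [->|mN0] := eqVneq m 0; first by rewrite qE mulr0.
  (* With [q = 0] the polynomial is affine in [s], and this [s] gives it the value -1. *)
  have /smq : (c + 1) / (2 * m) \is Num.real.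
    by rewrite ger0_real// divr_ge0 ?addr_ge0 ?mulr_ge0.
  rewrite qE !mulr0 (_ : _ + c = -1) ?oppr_ge0 ?ler10//.
  by field.
(* The minimizer of the polynomial when [m] is nonzero. *)
have /smq : q^-1 \is Num.real by rewrite ger0_real// invr_ge0.
rewrite (_ : _ + c = c - m / q); last by field.
by rewrite subr_ge0 ler_pdivrMr// lt_def qN0.
Qed.

(* Cauchy-Schwarz, obtained by evaluating at the multiples of [x] by
   [- s * (L x)^*] with [s] real. *)
Lemma form_bound (C : numClosedFieldType) (V : lmodType C) (q L : V -> C)
    (c : C) :
  (forall a x, q (a *: x) = `|a| ^+ 2 * q x) ->
  (forall a x, L (a *: x) = a * L x) ->
  (forall x, 0 <= q x) ->
  (forall x, 0 <= q x + (L x + (L x)^*) + c) ->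
  forall x, `|L x| ^+ 2 <= c * q x.
Proof.
move=> qZ LZ q0 qL x; apply: quadratic_ge0_bound => [||s sR].
- exact: exprn_ge0.
- exact: q0.
have := qL ((- s * (L x)^*) *: x).
rewrite qZ LZ !rmorphM/= conjCK rmorphN/= (CrealP sR) normrM normrN norm_conjC.
rewrite exprMn real_normK// normCK; congr (0 <= _); ring.
Qed.

Lemma addrJ_le_norm (C : numClosedFieldType) (z : C) : z + z^* <= 2 * `|z|.
Proof.
rewrite mulrC -ler_pdivrMr//; have := leif_Re_Creal z.
by rewrite Num.Theory.ReE => -[].
Qed.

Lemma near_invS_lt {R : realType} (e : R[i]) : 0 < e ->
  \forall n \near \oo, n.+1%:R^-1 < e.
Proof.
move=> e0; have eE : e = (complex.Re e)%:C%C by rewrite RRe_real// gtr0_real.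
have Re0 : 0 < complex.Re e by move: e0; rewrite {1}eE ltcR.
apply: filterS (near_infty_natSinv_lt (PosNum Re0)) => n.
by rewrite [in X in _ -> X]eE /= -ltcR fmorphV rmorph_nat.
Qed.

(** * Inner products, limits and density in a Hilbert space *)

Section HilbertSpaces.
Context {R : realType} (H : hilbertSpace R).
Local Notation K := (R[i] : numFieldType).
Local Notation "''[' u , v ]" := (inner H u v).

Lemma inner_conj (u v : H) : '[u, v] = '[v, u]^*.
Proof. by rewrite hermC mul1r. Qed.

Lemma normD_inner (u v : H) :
  `|u + v| ^+ 2 = `|u| ^+ 2 + ('[u, v] + '[u, v]^*) + `|v| ^+ 2.
Proof. by rewrite -!inner_norm dnormD addrAC. Qed.

Lemma normB_inner (u v : H) :
  `|u - v| ^+ 2 = `|u| ^+ 2 - ('[u, v] + '[u, v]^*) + `|v| ^+ 2.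
Proof. by rewrite -!inner_norm dnormB addrAC. Qed.

Lemma Cauchy_Schwarz_inner (u v : H) : `|'[u, v]| <= `|u| * `|v|.
Proof.
rewrite -(@ler_pXn2r _ 2) ?nnegrE ?mulr_ge0// exprMn mulrC.
(* Here the nonnegative form is the expansion of [|u + v| ^+ 2]. *)
apply: (@form_bound R[i] H (fun u => `|u| ^+ 2) (fun u => '[u, v])).
- by move=> a x; rewrite normrZ exprMn.
- by move=> a x; rewrite linearZl_LR.
- by move=> x; rewrite exprn_ge0.
- by move=> x; rewrite -normD_inner exprn_ge0.
Qed.

Lemma cvg_innerl (u : nat -> H) (h v : H) : u @ \oo --> h ->
  ('[u n, v] : K) @[n --> \oo] --> ('[h, v] : K).
Proof.
move=> /cvgrPdist_lt uh; apply/cvgrPdist_lt => e e0.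
have v0 : 0 < `|v| + 1 by rewrite ltr_wpDl.
have /uh : 0 < e / (`|v| + 1) by rewrite divr_gt0.
apply: filterS => n; rewrite ltr_pdivlMr// => une.
rewrite -linearBl/=; apply: le_lt_trans une.
by rewrite (le_trans (Cauchy_Schwarz_inner _ _))// ler_wpM2l// lerDl.
Qed.

Lemma cvg_innerr (u : nat -> H) (h v : H) : u @ \oo --> h ->
  ('[v, u n] : K) @[n --> \oo] --> ('[v, h] : K).
Proof.
move=> uh; rewrite inner_conj.
rewrite (_ : (fun n => _) = fun n => '[u n, v]^*); last first.
  by apply/funext => n; rewrite inner_conj.
apply: (@cvg_comp _ _ _ _ _ _ (nbhs ('[h, v] : K))).
  exact: cvg_innerl.
exact: conj_continuous.
Qed.

Lemma dense_approx (D : set H) (h : H) (e : K) : closure D = [set: H] ->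
  0 < e -> exists2 u, D u & `|h - u| < e.
Proof.
move=> Dd e0; have : closure D h by rewrite Dd.
have /[swap]/[apply] : nbhs h (ball h e) by exact: nbhsx_ballx.
by move=> [u [Du]]; rewrite -ball_normE; exists u.
Qed.

Lemma dense_seq (D : set H) (h : H) : closure D = [set: H] ->
  exists2 u : nat -> H, forall n, D (u n) & u @ \oo --> h.
Proof.
move=> Dd.
have /choice[u uP] : forall n : nat, exists u,
    D u /\ `|h - u| < n.+1%:R^-1 :> R[i].
  by move=> n; have [|u] := @dense_approx D h n.+1%:R^-1 Dd; [|exists u].
exists u => [n|]; first by have [] := uP n.
apply/cvgrPdist_lt => e e0.
have /= := near_invS_lt e e0; apply: filterS => n.
by apply: lt_trans; have [] := uP n.
Qed.

Lemma inner_dense_eq (D : set H) (v w : H) : closure D = [set: H] ->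
  (forall u, D u -> '[u, v] = '[u, w]) -> v = w.
Proof.
move=> Dd uvw; apply/eqP; rewrite -subr_eq0; apply/eqP/inner_sepr => h.
have [u Du uh] := @dense_seq D h Dd.
apply: (@cvg_unique K (@norm_hausdorff _ K) _ _ _ _ (cvg_innerl _ _ _ uh)).
rewrite (_ : (fun n => _) = fun _ => 0); first exact: cvg_cst.
by apply/funext => n; rewrite linearBr/= uvw// subrr.
Qed.

(** * Riesz representation by minimization *)

Section Riesz.
Context {E : lmodType R[i]} (kap : {linear E -> H}) (L : {scalar E}) (M : R).
Context (M_ge0 : 0 <= M).
Context (L_bounded : forall x, `|L x| ^+ 2 <= M%:C%C * `|kap x| ^+ 2).

(** If [h] represents [L], this is [|kap x - h| ^+ 2 - |h| ^+ 2], so minimizing it amounts to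
    approximating [h] by values of [kap]. *)
Let f x : R[i] := `|kap x| ^+ 2 - (L x + (L x)^*).

Let f_ge x : - M%:C%C <= f x.
Proof.
have M0 : 0 <= M%:C%C :> R[i] by rewrite ler0c.
rewrite /f lerNl opprB lerBlDr.
apply: le_trans (addrJ_le_norm _ _) _.
(* After squaring, the bound on [L] reduces the claim to the inequality between arithmetic and
   geometric means of [M] and [|kap x| ^+ 2]. *)
rewrite -(@ler_pXn2r _ 2) ?nnegrE ?mulr_ge0 ?addr_ge0 ?exprn_ge0//.
rewrite exprMn; apply: (@le_trans _ _ (2 ^+ 2 * (M%:C%C * `|kap x| ^+ 2))).
  by rewrite ler_wpM2l// exprn_ge0.
rewrite -subr_ge0 (_ : _ - _ = (M%:C%C - `|kap x| ^+ 2) ^+ 2); last by ring.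
by rewrite real_exprn_even_ge0// realB// ger0_real// exprn_ge0.
Qed.

Let f_Re x : f x = (complex.Re (f x))%:C%C.
Proof.
rewrite RRe_real// -[f x](addrK M%:C%C) realB// ger0_real ?ler0c//.
by rewrite -lerBlDr sub0r f_ge.
Qed.

Let f_inf : exists2 d : R[i], forall x, d <= f x &
  forall n : nat, exists x, f x < d + n.+1%:R^-1.
Proof.
pose D : set R := range (fun x => complex.Re (f x)).
have Dlb : has_lbound D.
  by exists (- M) => _ [x _ <-]; rewrite -lecR -f_Re rmorphN f_ge.
have Dinf : has_inf D by split=> //; exists (complex.Re (f 0)), 0.
exists (inf D)%:C%C => [x|n].
  by rewrite f_Re lecR; apply: ge_inf => //; exists x.
have [|_ [x _ <-] xd] := @inf_adherent _ D n.+1%:R^-1 _ Dinf.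
  by rewrite invr_gt0.
exists x; rewrite f_Re (_ : _ + _ = (inf D + n.+1%:R^-1)%:C%C) ?ltcR//.
by rewrite rmorphD/= fmorphV rmorph_nat.
Qed.

(** The terms in [L] cancel by linearity, leaving the parallelogram identity. Two near-minimizers of
    [f] thus have close images under [kap]. *)
Let parallelogram x y : `|kap x - kap y| ^+ 2 =
  2 * f x + 2 * f y - 4 * f (2^-1 *: (x + y)).
Proof.
rewrite normB_inner /f [kap (_ *: _)]linearZ [L (_ *: _)]linearZ/=.
rewrite [kap (x + y)]linearD [L (x + y)]linearD normrZ exprMn normD_inner.
rewrite rmorphM rmorphD fmorphV rmorph_nat normfV normr_nat/=.
by field.
Qed.

Lemma Riesz_representer : exists h : H, forall x, L x = '[kap x, h].
Proof.
have [d d_le /choice[u u_lt]] := f_inf.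
pose v n : H := kap (u n).
have [h uh] : exists h : H, v @ \oo --> h.
  suff ucauchy : cauchy (v @ \oo).
    by exists (lim (v @ \oo)); exact: (@cauchy_cvg H _ _ ucauchy).
  apply/cauchy_ballP => e e0.
  (* If two values of [f] are within [e ^+ 2 / 4] of the infimum [d], the parallelogram identity
     bounds the squared distance by [e ^+ 2]. *)
  have e4 : 0 < e ^+ 2 / 4 by rewrite divr_gt0 ?exprn_gt0.
  pose A := [set n | n.+1%:R^-1 < e ^+ 2 / 4 :> R[i]].
  have Au : (v @ \oo) (v @` A).
    by have := near_invS_lt _ e4; apply: filterS => n; exists n.
  exists (v @` A, v @` A) => // -[_ _] [[n An <-] [m Am <-]].
  rewrite -ball_normE /ball_/= -(@ltr_pXn2r _ 2) ?nnegrE ?(ltW e0)//.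
  rewrite parallelogram.
  have le4 : 4 * d <= 4 * f (2^-1 *: (u n + u m)) by rewrite ler_wpM2l.
  apply: le_lt_trans (lerB (lexx _) le4) _.
  have -> : e ^+ 2 = 2 * (d + e ^+ 2 / 4) + 2 * (d + e ^+ 2 / 4) - 4 * d.
    by field.
  rewrite ltrD2r; apply: ltrD; rewrite ltr_pM2l//.
    by apply: lt_trans (u_lt _) _; rewrite ltrD2l.
  by apply: lt_trans (u_lt _) _; rewrite ltrD2l.
exists h => x.
(* Approximate first-order condition: [f (u n)] exceeds no [f (z + u n)] by more than [n.+1%:R^-1],
   which is the nonnegativity that [form_bound] requires. *)
have un n : `|'[kap x, kap (u n)] - L x| ^+ 2 <= n.+1%:R^-1 * `|kap x| ^+ 2.
  apply: (@form_bound R[i] E (fun x => `|kap x| ^+ 2)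
    (fun x => '[kap x, kap (u n)] - L x)) => [a z|a z|z|z].
  - by rewrite linearZ/= normrZ exprMn.
  - by rewrite [kap _]linearZ [L _]linearZ linearZl_LR/= mulrBr.
  - exact: exprn_ge0.
  have := le_trans (ltW (u_lt n)) (lerD (d_le (z + u n)) (lexx _)).
  rewrite -subr_ge0; congr (0 <= _).
  rewrite /f !linearD/= normD_inner !rmorphB !rmorphD/=.
  by ring.
apply: (@cvg_unique K (@norm_hausdorff _ K)
  ('[kap x, v n] @[n --> \oo])); last exact: cvg_innerr.
apply/cvgrPdist_lt => e e0.
(* The summand 1 keeps the divisor positive when [kap x = 0]. *)
have q0 : 0 < `|kap x| ^+ 2 + 1 by rewrite ltr_wpDl// exprn_ge0.
have e1 : 0 < e ^+ 2 / (`|kap x| ^+ 2 + 1) by rewrite divr_gt0// exprn_gt0.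
have := near_invS_lt _ e1; apply: filterS => n /=; rewrite ltr_pdivlMr// => ne.
rewrite distrC -(@ltr_pXn2r _ 2) ?nnegrE ?(ltW e0)//.
apply: le_lt_trans (un n) (le_lt_trans _ ne).
by rewrite ler_wpM2l// ?invr_ge0// lerDl.
Qed.

End Riesz.
End HilbertSpaces.

(** Both formulas for the quadratic form are proved by this criterion. It includes [has_sup],
    without which the value of [sup] carries no information. *)
Lemma sup_eq {R : realType} (D : set R) (s : R) :
  (forall r, D r -> r <= s) ->
  (forall e, 0 < e -> exists2 r, D r & s <= r + e) ->
  has_sup D /\ sup D = s.
Proof.
move=> Ds sD; have Dsup : has_sup D.
  by split; [have [r Dr _] := sD 1 ltr01; exists r|exists s].
split=> //; apply/eqP; rewrite eq_le ge_sup//=; last by case: Dsup.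
apply/ler_addgt0Pr => e /sD[r Dr sr].
by apply: le_trans sr _; rewrite lerD2r ub_le_sup//; case: Dsup.
Qed.

(** * Weak continuity and quadratic forms of operator matrices *)

Section OperatorMatrices.
Context {R : realType} {F1 E1 F2 E2 : lmodType R[i]}.
Context {P1 : antiDualPair F1 E1} {P2 : antiDualPair F2 E2}.

Lemma weakOpB (T T' : E1 -> F2) : weakOp P1 P2 T -> weakOp P1 P2 T' ->
  weakOp P1 P2 (fun x => T x - T' x).
Proof.
move=> /weakOpP[Tlin [U UP]] /weakOpP[T'lin [U' U'P]]; apply/weakOpP; split.
  by move=> a x y; rewrite Tlin T'lin scalerBr opprD addrACA.
exists (fun y => U y - U' y) => x y.
by rewrite !linearBl/= UP U'P rmorphB.
Qed.

Lemma opMatrix_weakOp (A : E1 -> F1) (B : E1 -> F2) (C : E2 -> F2) :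
  weakOp P1 P1 A -> weakOp P1 P2 B -> weakOp P2 P2 C ->
  weakOp (prod_pair P1 P2) (prod_pair P1 P2) (opMatrix A (adjoint P1 P2 B) B C).
Proof.
move=> /weakOpP[Alin [A' A'P]] /[dup] /weakOp_adjoint B'P /weakOpP[Blin _].
move=> /weakOpP[Clin [C' C'P]].
have B'lin : linear (adjoint P1 P2 B).
  move=> a y z; apply: adjoint_unique => x.
  rewrite linearPr/= linearPl/= rmorphD rmorphM/=.
  by rewrite !B'P.
apply/weakOpP; split=> [a [x1 x2] [y1 y2]|].
  rewrite /opMatrix/= Alin B'lin Blin Clin.
  by congr (_, _); rewrite addrACA -scalerDr.
(* The transposed matrix of adjoints, the adjoint of [B^*] being [B]. *)
exists (fun y => (A' y.1 + adjoint P1 P2 B y.2, B y.1 + C' y.2)).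
move=> [x1 x2] [y1 y2]; rewrite /= /prod_pairing/= !linearDl/=.
rewrite !rmorphD/= -B'P A'P C'P [P2 (B y1) x2]B'P conjCK.
by rewrite -!addrA; congr (_ + _); rewrite addrCA.
Qed.

Lemma opMatrix_form (A : E1 -> F1) (B : E1 -> F2) (C : E2 -> F2) (x : E1)
    (y : E2) : weakOp P1 P2 B ->
  prod_pair P1 P2 (opMatrix A (adjoint P1 P2 B) B C (x, y)) (x, y) =
  P1 (A x) x + (P2 (B x) y + (P2 (B x) y)^*) + P2 (C y) y.
Proof.
move=> /weakOp_adjoint B'P; rewrite /= /prod_pairing/= !linearDl/= B'P conjCK.
by rewrite -!addrA; congr (_ + _); rewrite addrCA.
Qed.

End OperatorMatrices.

(** * The completion of the range of [A] and the representing vectors *)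

Section Completion.
Context {R : realType} {F1 E1 F2 E2 : lmodType R[i]}.
Context {P1 : antiDualPair F1 E1} {P2 : antiDualPair F2 E2}.
Context {A : E1 -> F1} {B : E1 -> F2}.
Context (A_op : weakOp P1 P1 A) (B_op : weakOp P1 P2 B).
Context {HA : hilbertSpace R} {k : F1 -> HA}.
Context (HA_completion : is_completion P1 A k).
Local Notation "''[' u , v ]" := (inner HA u v).

(** The map [k] is linear only on the range of [A], whereas this composite is linear on all of [E1]
    and can be bundled as [kap]. *)
Let kA x := k (A x).

Fact kA_linear : linear kA.
Proof.
have [Alin _] := A_op; move=> a x y /=.
by rewrite /kA Alin (completion_linear HA_completion).
Qed.

Let kap : {linear E1 -> HA} := HB.pack kA
  (GRing.isLinear.Build _ _ _ _ kA kA_linear).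

Lemma inner_kA x x' : '[k (A x), k (A x')] = P1 (A x) x'.
Proof. exact: completion_inner HA_completion x x'. Qed.

Lemma norm_kA x : `|k (A x)| ^+ 2 = P1 (A x) x.
Proof. by rewrite -inner_norm inner_kA. Qed.

Lemma kA_dense_eq (v w : HA) :
  (forall x, '[k (A x), v] = '[k (A x), w]) -> v = w.
Proof.
move=> vw; apply: (@inner_dense_eq _ HA _ v w (completion_dense HA_completion)).
by move=> _ [_ [x _ <-] <-].
Qed.

Lemma kA_approx h (e : R[i]) : 0 < e ->
  exists x, `|k (A x) - h| ^+ 2 < e.
Proof.
move=> e0; have se0 : 0 < sqrtC e by rewrite sqrtC_gt0.
have [_ [_ [x _ <-] <-] xe] :=
  @dense_approx _ _ _ (h) _ (completion_dense HA_completion) se0.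
by exists x; rewrite distrC -(sqrtCK e) ltr_pXn2r ?nnegrE ?(ltW se0)//.
Qed.

(** For fixed [y], positivity of the matrix at [(z, y)] is the hypothesis of [form_bound] with
    constant [P2 (C y) y]. *)
Lemma completes_bound {C : E2 -> F2} : completes P1 P2 A B C ->
  forall x y, `|P2 (B x) y| ^+ 2 <= P2 (C y) y * P1 (A x) x.
Proof.
move=> [_ [_ C_ge0]] x y; have [Blin _] := B_op; rewrite -norm_kA.
pose Bl : {linear E1 -> F2} := HB.pack B (GRing.isLinear.Build _ _ _ _ B Blin).
apply: (@form_bound R[i] E1 (fun x => `|kap x| ^+ 2) (fun x => P2 (Bl x) y)).
- by move=> a z; rewrite linearZ/= normrZ exprMn.
- by move=> a z; rewrite linearZ/= linearZl_LR.
- by move=> z; rewrite exprn_ge0.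
by move=> z; rewrite norm_kA -opMatrix_form.
Qed.

Lemma functional_representer :
  (forall y2, exists M : R, 0 <= M /\
    forall x1, `|P2 (B x1) y2| ^+ 2 <= M%:C%C * P1 (A x1) x1) ->
  exists hB : E2 -> HA, forall x y, P2 (B x) y = '[k (A x), hB y].
Proof.
move=> B_bd; suff /choice[hB hBP] : forall y, exists h, forall x,
    P2 (B x) y = '[k (A x), h] by exists hB.
move=> y; have [M [M0 BM]] := B_bd y; have [Blin _] := B_op.
pose L x := P2 (B x) y.
have L_lin : scalar L by move=> a u v; rewrite /L Blin linearPl.
pose Ll : {scalar E1} := HB.pack L (GRing.isLinear.Build _ _ _ _ L L_lin).
apply: (@Riesz_representer _ HA _ kap Ll M M0) => x.
by rewrite norm_kA; exact: BM.
Qed.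

(** In other words, the adjoint of [J] sends [x] to [k (A x)]: the two vectors have equal inner
    products with the dense set of all [k (A x')]. *)
Lemma canonical_embedding_form {J : HA -> F1} : canonical_embedding P1 A k J ->
  forall h x, P1 (J h) x = '[h, k (A x)].
Proof.
move=> [/weakOpP[_ [J' J'P]] JkA] h x; rewrite J'P /= -inner_conj.
congr ('[h, _]); apply: kA_dense_eq => x'.
by rewrite inner_conj -J'P JkA inner_kA.
Qed.

(** * The extension [S], the operator [S S^*] and its quadratic form *)

Section Extension.
Context (P2_complete : weak_star_seq_complete P2).
Context {hB : E2 -> HA} (hBP : forall x y, P2 (B x) y = '[k (A x), hB y]).

Lemma representer_linear : linear hB.
Proof.
move=> a y z; apply: kA_dense_eq => x.
by rewrite -hBP !linearPr/= !hBP.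
Qed.

(** Approximate [h] by vectors [k (A (x n))]. The pairings of [B (x n)] with [y] converge to the
    inner product of [h] and [hB y], so sequential completeness supplies the value at [h]. *)
Lemma extension_exists :
  exists S : HA -> F2, forall h y, P2 (S h) y = '[h, hB y].
Proof.
suff /choice[S SP] : forall h, exists f, forall y, P2 f y = '[h, hB y].
  by exists S.
move=> h; have [u uD uh] := @dense_seq _ _ _ h (completion_dense HA_completion).
have /choice[x xu] : forall n, exists x, u n = k (A x).
  by move=> n; have [_ [x _ <-] <-] := uD n; exists x.
apply: (@weakF_seq_complete _ _ _ P2 P2_complete (fun n => B (x n))
  (fun y => '[h, hB y])) => y.
rewrite (_ : (fun n => _) = fun n => '[u n, hB y]); first exact: cvg_innerl.
by apply/funext => n; rewrite hBP xu.
Qed.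

Context {S : HA -> F2} (SP : forall h y, P2 (S h) y = '[h, hB y]).

Lemma extension_kA x : S (k (A x)) = B x.
Proof.
apply/eqP; rewrite -subr_eq0; apply/eqP/(pairing_sepl (a:=P2)) => y.
by rewrite linearBl/= SP hBP subrr.
Qed.

Lemma extension_weakOp : weakOp (hilbert_pair HA) P2 S.
Proof.
apply/weakOpP; split=> [a h h'|]; last first.
  by exists hB => h y; rewrite SP/= -inner_conj.
apply/eqP; rewrite -subr_eq0; apply/eqP/(pairing_sepl (a:=P2)) => y.
by rewrite linearBl/= linearPl/= !SP linearPl/= subrr.
Qed.

Lemma extension_adjoint y : adjoint (hilbert_pair HA) P2 S y = hB y.
Proof. by apply: adjoint_unique => h; rewrite SP/= -inner_conj. Qed.

(** The adjoint of [S'] agrees with [hB] against every [k (A x)], hence equals it by density. *)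
Lemma extension_unique {S' : HA -> F2} : weakOp (hilbert_pair HA) P2 S' ->
  (forall x, S' (k (A x)) = B x) -> S' = S.
Proof.
move=> /weakOpP[_ [T S'P]] S'B; apply/funext => h.
apply/eqP; rewrite -subr_eq0; apply/eqP/(pairing_sepl (a:=P2)) => y.
rewrite linearBl/= SP S'P/= -inner_conj (_ : T y = hB y) ?subrr//.
by apply: kA_dense_eq => x; rewrite -hBP -S'B S'P/= -inner_conj.
Qed.

(** This is [S S^*], by [extension_adjoint]. *)
Let AB y := S (hB y).

Lemma extension_form y : P2 (AB y) y = `|hB y| ^+ 2.
Proof. by rewrite SP inner_norm. Qed.

Lemma SSadj_positive : positiveOp P2 AB.
Proof.
split; last by move=> y; rewrite extension_form exprn_ge0.
have [Slin _] := extension_weakOp.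
apply/weakOpP; split=> [a y z|]; first by rewrite /AB representer_linear Slin.
by exists AB => y z; rewrite !SP -inner_conj.
Qed.

Lemma SSadj_completes : completes P1 P2 A B AB.
Proof.
have [AB_op _] := SSadj_positive.
split=> //; split=> [|[x y]]; first exact: opMatrix_weakOp.
by rewrite opMatrix_form// extension_form hBP -norm_kA -normD_inner exprn_ge0.
Qed.

Lemma completing_square x y :
  P2 (B x) y + (P2 (B x) y)^* - P1 (A x) x =
  `|hB y| ^+ 2 - `|k (A x) - hB y| ^+ 2.
Proof. by rewrite normB_inner hBP -norm_kA; ring. Qed.

Lemma SSadj_smallest {C : E2 -> F2} : positiveOp P2 C ->
  completes P1 P2 A B C -> leOp P2 AB C.
Proof.
move=> [C_op _] [_ [_ C_ge0]]; split=> [|y].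
  by apply: weakOpB => //; case: SSadj_positive.
rewrite linearBl/= subr_ge0 extension_form; apply/ler_addgt0Pr => e.
(* With [k (A x)] close to [- hB y] the square in the matrix form is less than [e], so positivity
   leaves [|hB y| ^+ 2 <= P2 (C y) y + e]. *)
move=> /(kA_approx (- hB y))[x]; rewrite opprK => /ltW xe.
rewrite -lerBlDr (le_trans (lerB (lexx _) xe))// -subr_ge0.
have := C_ge0 (x, y); rewrite opMatrix_form// hBP -norm_kA.
by rewrite normD_inner; congr (0 <= _); ring.
Qed.

(** By [completing_square] the elements of [D] are [|hB y| ^+ 2] minus a squared distance that
    density makes arbitrarily small. *)
Lemma sup_completing_square {y : E2} {s : R} : s%:C%C = `|hB y| ^+ 2 ->
  let D := [set r : R | exists x : E1,
    r%:C%C = P2 (B x) y + P1 (adjoint P1 P2 B y) x - P1 (A x) x] in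
  has_sup D /\ sup D = s.
Proof.
move=> sE D; have DE r : D r <->
    exists x, r%:C%C = `|hB y| ^+ 2 - `|k (A x) - hB y| ^+ 2.
  split=> -[x rx]; exists x; move: rx; rewrite -completing_square;
  by rewrite (weakOp_adjoint _ _ _ B_op) conjCK.
apply: sup_eq => [r /DE[x rx]|e e0].
  by rewrite -lecR rx sE gerBl exprn_ge0.
have [|x xe] := @kA_approx (hB y) e%:C%C; first by rewrite ltcR.
exists (s - complex.Re (`|k (A x) - hB y| ^+ 2)).
  by apply/DE; exists x; rewrite rmorphB/= sE RRe_real//.
rewrite -lecR rmorphD rmorphB/= RRe_real; last by rewrite ger0_real// exprn_ge0.
by rewrite -addrA lerDl addrC subr_ge0 ltW.
Qed.

(** Cauchy-Schwarz gives the upper bound. It is approached by normalizing some [x] whose image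
    [k (A x)] is close to [hB y]. *)
Lemma sup_unit_ball {y : E2} {s : R} : s%:C%C = `|hB y| ^+ 2 ->
  let D := [set r : R | exists2 x : E1,
    P1 (A x) x <= 1 & r%:C%C = `|P2 (B x) y| ^+ 2] in
  has_sup D /\ sup D = s.
Proof.
move=> sE D; apply: sup_eq => [r [x Ax1 rx]|e e0].
  rewrite -lecR rx sE hBP.
  apply: (@le_trans _ _ ((`|k (A x)| * `|hB y|) ^+ 2)).
    by rewrite ler_pXn2r ?nnegrE ?mulr_ge0// Cauchy_Schwarz_inner.
  by rewrite exprMn norm_kA ler_piMl// exprn_ge0.
have [|x xe] := @kA_approx (hB y) e%:C%C; first by rewrite ltcR.
have normsqE : forall z : R[i], (complex.Re (`|z| ^+ 2))%:C%C = `|z| ^+ 2.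
  by move=> z; rewrite RRe_real// ger0_real// exprn_ge0.
have sxe : s%:C%C - e%:C%C <= P2 (B x) y + (P2 (B x) y)^* - P1 (A x) x.
  by rewrite completing_square sE lerD2l lerN2 ltW.
(* A zero vector cannot be normalized, but then [sxe] gives [s <= e] and the element 0 of [D]
   suffices. *)
have [Axx|Axx] := eqVneq (k (A x)) 0.
  exists 0.
    exists 0.
      by rewrite -norm_kA -[k (A 0)]/(kap 0) linear0 normr0 expr0n.
    by rewrite hBP -[k (A 0)]/(kap 0) linear0 linear0l normr0 expr0n.
  move: sxe; rewrite -norm_kA hBP Axx linear0l normr0 expr0n/= rmorph0 !subr0.
  by rewrite addr0 -rmorphB lecR lerBlDr.
pose z := (`|k (A x)|^-1 : R[i]) *: x.
have kAz : k (A z) = `|k (A x)|^-1 *: k (A x).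
  by rewrite -![k (A _)]/(kap _) linearZ.
exists (complex.Re (`|P2 (B z) y| ^+ 2)).
  exists z => //.
  by rewrite -norm_kA kAz normrZ normfV normr_id mulVf ?expr1n// normr_eq0.
rewrite -lerBlDr -lecR rmorphB/= normsqE; apply: le_trans sxe _.
rewrite !hBP kAz linearZl_LR/= normrM normfV normr_id exprMn -hBP -norm_kA.
rewrite lerBlDr; apply: le_trans (addrJ_le_norm _ _) _.
have a0 : 0 < `|k (A x)| by rewrite normr_gt0.
rewrite -subr_ge0.
set t := `|P2 (B x) y|; set a := `|k (A x)|.
(* The inequality [2 * t <= (t / a) ^+ 2 + a ^+ 2] passes from the completed square to the value at
   the normalized vector. *)
rewrite (_ : _ - _ = (a^-1 * t - a) ^+ 2); last by field; rewrite gt_eqF.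
by rewrite real_exprn_even_ge0// realB ?realM ?realV ?normr_real.
Qed.

End Extension.
End Completion.

(** * The three equivalent conditions and the minimal completion *)

Theorem theorem2p1 (R : realType) (F1 E1 F2 E2 : lmodType R[i])
    (P1 : antiDualPair F1 E1) (P2 : antiDualPair F2 E2)
    (P1_complete : weak_star_seq_complete P1)
    (P2_complete : weak_star_seq_complete P2)
    (A : E1 -> F1) (B : E1 -> F2)
    (A_op : weakOp P1 P1 A) (B_op : weakOp P1 P2 B) (A_ge0 : positiveOp P1 A)
    (HA : hilbertSpace R) (k : F1 -> HA) (HA_completion : is_completion P1 A k)
    (J : HA -> F1) (J_embedding : canonical_embedding P1 A k J) :
  let cond_i := exists C : E2 -> F2, positiveOp P2 C /\ completes P1 P2 A B C in
  let cond_ii := forall y2 : E2, exists M : R, 0 <= M /\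
    forall x1 : E1, `|P2 (B x1) y2| ^+ 2 <= M%:C%C * P1 (A x1) x1 in
  let cond_iii := range (adjoint P1 P2 B) `<=` range J in
  [/\ cond_i <-> cond_ii,
      cond_ii <-> cond_iii &
      cond_i \/ cond_ii \/ cond_iii ->
      (forall x1 x1' : E1, A x1 = A x1' -> B x1 = B x1') /\
      exists S0 : HA -> F2,
        [/\ forall x1 : E1, S0 (k (A x1)) = B x1,
            {in k @` range A &, forall h h' : HA, forall a : R[i],
              S0 (a *: h + h') = a *: S0 h + S0 h'},
            weakly_continuous_on (hilbert_pair HA) P2 (k @` range A) S0 &
            exists S : HA -> F2,
              let is_extension (S' : HA -> F2) :=
                weakOp (hilbert_pair HA) P2 S' /\
                {in k @` range A, S' =1 S0} in
              let AB := S \o adjoint (hilbert_pair HA) P2 S in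
              [/\ is_extension S,
                  forall S' : HA -> F2, is_extension S' -> S' = S,
                  positiveOp P2 AB /\ completes P1 P2 A B AB,
                  forall C : E2 -> F2, positiveOp P2 C ->
                    completes P1 P2 A B C -> leOp P2 AB C &
                  forall y2 : E2,
                    let D1 := [set r : R | exists2 x1 : E1,
                      P1 (A x1) x1 <= 1 & r%:C%C = `|P2 (B x1) y2| ^+ 2] in
                    let D2 := [set r : R | exists x1 : E1,
                      r%:C%C = P2 (B x1) y2 + P1 (adjoint P1 P2 B y2) x1
                               - P1 (A x1) x1] in
                    [/\ has_sup D1, has_sup D2,
                        P2 (AB y2) y2 = (sup D1)%:C%C &
                        P2 (AB y2) y2 = (sup D2)%:C%C]]]].
Proof.
move=> cond_i cond_ii cond_iii.
(* The three conditions are linked through this one: (i) implies (ii), (ii) implies it, it implies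
   (i), and it is equivalent to (iii). *)
pose represented := exists hB : E2 -> HA,
  forall x y, P2 (B x) y = inner HA (k (A x)) (hB y).
have JP := canonical_embedding_form HA_completion J_embedding.
have BadjP := weakOp_adjoint _ _ _ B_op.
have i_ii : cond_i -> cond_ii.
  move=> [C [[_ C0] AC]] y; exists (complex.Re (P2 (C y) y)).
  have CyE : (complex.Re (P2 (C y) y))%:C%C = P2 (C y) y.
    by rewrite RRe_real// ger0_real.
  split=> [|x]; first by rewrite -ler0c CyE.
  by rewrite CyE (completes_bound A_op B_op HA_completion AC).
have ii_rep : cond_ii -> represented.
  exact: (functional_representer A_op B_op HA_completion).
have iii_rep : cond_iii -> represented.
  move=> BJ; suff /choice[hB hBP] : forall y, exists h, forall x,
    P2 (B x) y = inner HA (k (A x)) h by exists hB.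
  (* Any preimage of [B^* y] under [J] is a representing vector. *)
  move=> y; have [h _ hE] : range J (adjoint P1 P2 B y) by apply: BJ; exists y.
  by exists h => x; rewrite BadjP -hE JP -inner_conj.
have rep_iii : represented -> cond_iii.
  move=> [hB hBP] _ [y _ <-]; exists (hB y) => //.
  apply/esym/adjoint_unique => x.
  by rewrite JP -inner_conj.
have rep_i : represented -> cond_i.
  move=> [hB hBP].
  have [S SP] := extension_exists HA_completion P2_complete hBP.
  exists (S \o hB); split.
    exact: (SSadj_positive HA_completion hBP SP).
  exact: (SSadj_completes A_op B_op HA_completion hBP SP).
split.
- by split=> // /ii_rep/rep_i.
- by split=> [/ii_rep/rep_iii|/iii_rep/rep_i/i_ii].
move=> conds; have [hB hBP] : represented.
  by case: conds => [/i_ii/ii_rep|[/ii_rep|/iii_rep]].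
have [S SP] := extension_exists HA_completion P2_complete hBP.
have SkA := extension_kA hBP SP.
have S_op := extension_weakOp SP.
have SadjE : S \o adjoint (hilbert_pair HA) P2 S = S \o hB.
  by apply/funext => y /=; rewrite (extension_adjoint SP).
split=> [x x' Axx'|]; first by rewrite -!SkA Axx'.
(* [S0] is a total function specified on the image of the range of [A], so [S] itself serves. *)
exists S; split=> //.
- by move=> h h' _ _ a; have [->] := S_op.
- exact/continuous_subspaceT/(proj2 S_op).
exists S; split.
- by split.
- move=> S' [S'_op S'S].
  apply: (extension_unique HA_completion hBP SP S'_op) => x.
  by rewrite S'S ?SkA//; apply/mem_set; exists (A x) => //; exists x.
- rewrite SadjE; split; first exact: (SSadj_positive HA_completion hBP SP).
  exact: (SSadj_completes A_op B_op HA_completion hBP SP).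
- rewrite SadjE => C.
  exact: (SSadj_smallest B_op HA_completion hBP SP).
move=> y D1 D2; rewrite SadjE.
have sE : (complex.Re (`|hB y| ^+ 2))%:C%C = `|hB y| ^+ 2.
  by rewrite RRe_real// ger0_real// exprn_ge0.
have [D1_sup D1E] := sup_unit_ball A_op HA_completion hBP sE.
have [D2_sup D2E] := sup_completing_square B_op HA_completion hBP sE.
have SyE : P2 ((S \o hB) y) y = (complex.Re (`|hB y| ^+ 2))%:C%C.
  by rewrite sE; exact: (extension_form SP).
by split=> //; rewrite SyE; congr (_%:C%C); rewrite ?[sup D1]D1E ?[sup D2]D2E.
Qed.
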